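(* Let $G=(V,E)$ be a graph, $r\ge1$ an integer, and $k=\mathrm{adm}_r(G)$. The greedy algorithm described in the context produces a total order $\sigma$ of $V$ such that $\mathrm{col}_r(G_\sigma)\le k\cdot(k-1)^{r-1}$ and $\mathrm{wcol}_r(G_\sigma)\le \frac{k^{r+1}-1}{k-1}$.
   Context: A prefix order $\sigma$ of $V$ is a strict partial order that is downward total (if $a<_\sigma c$ and $b<_\sigma c$ then $a,b$ are comparable or equal); $a$ is ordered if $a<_\sigma b$ for some $b$, otherwise unordered. A sequence $(s_1,\dots,s_t)$ of distinct vertices determines the prefix order in which $s_i<_\sigma s_j$ for $i<j$ and $s_i<_\sigma w$ for every vertex $w$ not in the sequence (vertices not in the sequence are pairwise incomparable). For a prefix order $\sigma$, a $u$–$v$ path $P$ ($v\ne u$) of length at most $\ell$ is $\ell$-qualifying if $v\not<_\sigma u$ and all vertices of $P$ other than $u,v$ satisfy $p<_\sigma u$; it is weakly $\ell$-qualifying if $v\not<_\sigma u$ and all such $p$ satisfy $p<_\sigma v$. $\mathrm{reach}_r(u,G_\sigma)$ and $\mathrm{wreach}_r(u,G_\sigma)$ are the sets of endpoints $v$ of $r$-qualifying resp. weakly $r$-qualifying paths from $u$; $\mathrm{col}_r(G_\sigma)=\max_u|\mathrm{reach}_r(u,G_\sigma)|$, $\mathrm{wcol}_r(G_\sigma)=\max_u|\mathrm{wreach}_r(u,G_\sigma)|$. An $\ell$-qualifying $u$–$v$ path is shortest if there is no $(\ell-1)$-qualifying $u$–$v$ path. $\mathrm{bcon}_r(u,G_\sigma)$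 is the maximum number of $r$-qualifying paths from $u$ pairwise vertex-disjoint apart from $u$; $\mathrm{est}_r(u,G_\sigma)$ is the same maximum restricted to shortest $r$-qualifying paths. $\mathrm{adm}_r(G)=\min_\sigma\max_u\mathrm{bcon}_r(u,G_\sigma)$ over total orders $\sigma$. Algorithm: initialize a key $S[u]=\deg(u)$ for every $u\in V$ and let $\sigma$ be the empty sequence. While some vertex has not been placed: pick an unplaced vertex $u$ with minimum key $S[u]$, append $u$ to $\sigma$ and remove it from the pool of unplaced vertices; then for every $v\in\mathrm{reach}_r(u,G_\sigma)$ (with respect to the current prefix order $\sigma$) set $S[v]=\mathrm{est}_r(v,G_\sigma)$. Output the final sequence $\sigma$ as a total order.
   Formalization: The case k = adm_r(G) = 1 is excluded: there the bound (k^{r+1}-1)/(k-1) is undefined, and k(k-1)^{r-1} = 0 fails for r ≥ 2 (a single edge has col_2 = 1). *)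

(* Defs.v *)
(* Finite simple graph = symmetric irreflexive relation on a finType. *)
From mathcomp Require Import all_boot all_order all_algebra.
From mathcomp Require Import all_fingroup boolp.
Set Implicit Arguments. Unset Strict Implicit. Unset Printing Implicit Defensive.

Section Defs.
Variables (V : finType) (e : rel V).

(* Prefix order determined by a sequence s of distinct vertices:
   s_i < s_j for i < j, s_i < w for w not in s, others incomparable. *)
Definition pord (s : seq V) (a b : V) : bool :=
  (a \in s) && ((b \notin s) || (index a s < index b s)).

(* A path from u is encoded by u :: q (q = the vertices after u, its last
   element is the endpoint); its length is size q.  Paths are simple. *)
Definition is_path (u : V) (q : seq V) : bool :=
  [&& q != [::], path e u q & uniq (u :: q)].

Definition inner (u : V) (q : seq V) : seq V := behead (belast u q).

Definition qualp (s : seq V) (u : V) (q : seq V) : bool :=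
  [&& is_path u q, ~~ pord s (last u q) u & all (fun p => pord s p u) (inner u q)].

Definition wqualp (s : seq V) (u : V) (q : seq V) : bool :=
  [&& is_path u q, ~~ pord s (last u q) u & all (fun p => pord s p (last u q)) (inner u q)].

Definition qual (s : seq V) (l : nat) (u : V) (q : seq V) : bool :=
  qualp s u q && (size q <= l).
Definition wqual (s : seq V) (l : nat) (u : V) (q : seq V) : bool :=
  wqualp s u q && (size q <= l).

Definition shortest_qual (s : seq V) (r : nat) (u : V) (q : seq V) : Prop :=
  qual s r u q /\
  ~ (exists q', qual s (size q).-1 u q' /\ last u q' = last u q).

Definition reach (s : seq V) (r : nat) (u : V) : {set V} :=
  [set v | `[< exists q, qual s r u q /\ last u q = v >]].
Definition wreach (s : seq V) (r : nat) (u : V) : {set V} :=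
  [set v | `[< exists q, wqual s r u q /\ last u q = v >]].

Definition colr (s : seq V) (r : nat) : nat := \max_(u : V) #|reach s r u|.
Definition wcolr (s : seq V) (r : nat) : nat := \max_(u : V) #|wreach s r u|.

(* a family of m paths from u (given by their tails), each satisfying P,
   pairwise vertex-disjoint apart from u *)
Definition disj_family (P : seq V -> Prop) (m : nat) : Prop :=
  exists Q : seq (seq V),
    [/\ size Q = m, (forall q, q \in Q -> P q) & uniq (flatten Q)].

(* maximum over m; any such family has m <= #|V| (disjoint nonempty tails) *)
Definition bcon (s : seq V) (r : nat) (u : V) : nat :=
  \max_(m < #|V|.+1 | `[< disj_family (qual s r u) m >]) m.
Definition est (s : seq V) (r : nat) (u : V) : nat :=
  \max_(m < #|V|.+1 | `[< disj_family (shortest_qual s r u) m >]) m.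

(* total orders of V, as sequences enumerating V *)
Definition perm_order (p : {perm V}) : seq V := [seq p x | x <- enum V].

Definition max_bcon (s : seq V) (r : nat) : nat := \max_(u : V) bcon s r u.

Lemma adm_ex (r : nat) :
  exists n, [exists p : {perm V}, max_bcon (perm_order p) r == n].
Proof. by exists (max_bcon (perm_order 1%g) r); apply/existsP; exists 1%g. Qed.

Definition adm (r : nat) : nat := ex_minn (adm_ex r).

Definition deg (v : V) : nat := #|[set w | e v w]|.

(* key values S[.] after the vertices of rev rp have been placed in order *)
Fixpoint keys_rev (r : nat) (rp : seq V) (v : V) : nat :=
  match rp with
  | [::] => deg v
  | u :: rp' =>
      let sigma := rev rp in
      if v \in reach sigma r u then est sigma r v else keys_rev r rp' v
  end.

Definition keys (r : nat) (p : seq V) (v : V) : nat := keys_rev r (rev p) v.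

(* s is a possible output of the greedy algorithm (any tie-breaking) *)
Definition greedy_run (r : nat) (s : seq V) : Prop :=
  [/\ uniq s, (forall v : V, v \in s) &
      forall i, i < size s -> forall w : V, w \notin take i s ->
        keys r (take i s) (nth w s i) <= keys r (take i s) w].

End Defs.

(* Main.v *)
(** Placing a vertex only changes the estimates of the vertices it reaches, so
    the keys of the algorithm are always the current values of [est]. Among the
    unplaced vertices, the one that comes first in an order optimal for [adm]
    has [est <= adm]: cut its qualifying paths at their first vertex that is not
    smaller in the optimal order. Hence [est <= k] at every vertex of the output.

    For a vertex [u], join [u] to each vertex [v] that it (weakly) reaches by
    the lexicographically least shortest admissible walk, and consider the
    prefix tree of these walks. At a node ending in [w], cut each branch at its
    first vertex that is not below [w]. Minimality makes the cut branches
    shortest qualifying paths from [w], and the common tie-breaking makes them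
    disjoint, so a node has at most [k] children. For strong reachability the
    way back from [w] to [u], cut likewise, is one more disjoint path, which
    leaves at most [k - 1] children below the root. *)
Require Import Defs.
From mathcomp Require Import all_boot all_order all_algebra.
From mathcomp Require Import all_fingroup boolp.
Import GRing.Theory Num.Theory.
Set Implicit Arguments. Unset Strict Implicit. Unset Printing Implicit Defensive.

(** * Numerical comparison of words by length, then lexicographically *)

Section Words.
Variable V : finType.
Implicit Types (x : V) (q : seq V).

(* No digit is 0, so comparing values compares lengths first and then compares
   words of the same length lexicographically. *)
Definition wordval q : nat := foldl (fun a x => a * #|V|.+1 + (enum_rank x).+1) 0 q.

Lemma wordval_cat q1 q2 :
  wordval (q1 ++ q2) = wordval q1 * #|V|.+1 ^ size q2 + wordval q2.
Proof.
elim/last_ind: q2 => [|q2 x IH]; first by rewrite cats0 /= muln1 addn0.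
have W_rcons q y : wordval (rcons q y) = wordval q * #|V|.+1 + (enum_rank y).+1.
  by rewrite /wordval -cats1 foldl_cat.
by rewrite -rcons_cat !W_rcons IH size_rcons expnSr mulnDl mulnA addnA.
Qed.

Lemma wordval_cons x q :
  wordval (x :: q) = (enum_rank x).+1 * #|V|.+1 ^ size q + wordval q.
Proof. by rewrite -cat1s wordval_cat. Qed.

Lemma wordval_lt q : wordval q < #|V|.+1 ^ size q.
Proof.
elim: q => [|x q IH] //=; rewrite wordval_cons expnS.
apply: (@leq_trans ((enum_rank x).+2 * #|V|.+1 ^ size q)).
  by rewrite [X in _ < X]mulSn addnC ltn_add2r.
by rewrite leq_mul2r !ltnS ltn_ord orbT.
Qed.

(** The nonzero leading digit of a longer word contributes at least the power of the base that
    bounds the shorter value. *)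
Lemma wordval_size q1 q2 : wordval q1 <= wordval q2 -> size q1 <= size q2.
Proof.
apply: contraTT; rewrite -!ltnNge => lt12; apply: leq_trans (wordval_lt q2) _.
case: q1 lt12 => // x q1; rewrite ltnS => le12.
rewrite wordval_cons mulSn -addnA; apply: leq_trans (leq_addr _ _).
by rewrite leq_exp2l // ltnS; apply/card_gt0P; exists x.
Qed.

(** Blocks of equal length put the same weight on everything around them, so a minimal word has
    minimal blocks. *)
Lemma wordval_infix c q1 q2 d : size q1 = size q2 ->
  (wordval (c ++ q1 ++ d) <= wordval (c ++ q2 ++ d)) = (wordval q1 <= wordval q2).
Proof.
move=> E; rewrite !wordval_cat !size_cat E leq_add2l leq_add2r leq_mul2r.
by rewrite expn_eq0.
Qed.

Lemma wordval_inj q1 q2 : size q1 = size q2 -> wordval q1 = wordval q2 -> q1 = q2.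
Proof.
elim: q1 q2 => [|x q1 IH] [|y q2] //= [E]; rewrite !wordval_cons E => EW.
have q1lt := wordval_lt q1; have q2lt := wordval_lt q2; rewrite E in q1lt.
have pos : 0 < #|V|.+1 ^ size q2 by rewrite expn_gt0.
have EM := congr1 (modn^~ (#|V|.+1 ^ size q2)) EW.
have ED := congr1 (divn^~ (#|V|.+1 ^ size q2)) EW.
move: EM ED; rewrite /= !modnMDl !divnMDl // !modn_small // !divn_small // !addn0.
by move=> /(IH _ E) -> [/val_inj/enum_rank_inj ->].
Qed.

End Words.

(** * Flattened families of sequences *)

Section Sequences.
Variable T : eqType.

Lemma uniq_flatten_map (I : eqType) (F : I -> seq T) (js : seq I) :
  uniq js -> {in js, forall j, uniq (F j)} ->
  {in js &, forall i j x, x \in F i -> x \in F j -> i = j} ->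
  uniq (flatten [seq F j | j <- js]).
Proof.
elim: js => //= j js IH /andP[jNjs ujs] uF dF; rewrite cat_uniq uF ?mem_head //=.
rewrite IH //= ?andbT.
- apply/hasPn => x /flatten_mapP[i ijs xFi]; apply: contraNN jNjs => xFj.
  by rewrite (dF _ _ _ _ _ xFj xFi) ?mem_head // inE ijs orbT.
- by move=> i ijs; apply: uF; rewrite inE ijs orbT.
- by move=> i k ijs kjs; apply: dF; rewrite inE ?ijs ?kjs orbT.
Qed.

Lemma subseq_flatten_map (f : seq T -> seq T) (Q : seq (seq T)) :
  (forall q, subseq (f q) q) -> subseq (flatten (map f Q)) (flatten Q).
Proof. by move=> sf; elim: Q => //= q Q IH; rewrite cat_subseq. Qed.

Lemma size_flatten_ge (Q : seq (seq T)) :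
  {in Q, forall q, q != [::]} -> size Q <= size (flatten Q).
Proof.
elim: Q => //= q Q IH nQ; rewrite size_cat -add1n leq_add //.
  by rewrite lt0n size_eq0 nQ ?mem_head.
by apply: IH => q' q'Q; apply: nQ; rewrite inE q'Q orbT.
Qed.

End Sequences.

(** * Qualifying paths, maximal disjoint families and truncation *)

Section Orders.
Variables (V : finType) (e : rel V).
Implicit Types (s : seq V) (u v w p : V) (q : seq V).

Lemma pord_total s a b : (forall v, v \in s) ->
  pord s a b = (index a s < index b s).
Proof. by move=> sV; rewrite /pord !sV. Qed.

Lemma pord_unplaced s p w : w \notin s -> pord s p w = (p \in s).
Proof. by rewrite /pord => ->; rewrite andbT. Qed.

Lemma is_path_rcons u q x :
  is_path e u (rcons q x) = path e u (rcons q x) && uniq (u :: rcons q x).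
Proof. by rewrite /is_path; case: q. Qed.

Lemma qualp_rcons s u q x : qualp e s u (rcons q x) =
  [&& path e u (rcons q x), uniq (u :: rcons q x), ~~ pord s x u & all (pord s ^~ u) q].
Proof. by rewrite /qualp is_path_rcons last_rcons /inner belast_rcons /= !andbA. Qed.

Lemma wqualp_rcons s u q x : wqualp e s u (rcons q x) =
  [&& path e u (rcons q x), uniq (u :: rcons q x), ~~ pord s x u & all (pord s ^~ x) q].
Proof.
by rewrite /wqualp is_path_rcons last_rcons /inner belast_rcons /= !andbA.
Qed.

Lemma qualpN0 s u q : qualp e s u q -> q != [::].
Proof. by case/and3P=> /and3P[]. Qed.

Lemma eq_qualp s s' u : pord s ^~ u =1 pord s' ^~ u -> qualp e s u =1 qualp e s' u.
Proof. by move=> E q; rewrite /qualp E (eq_all E). Qed.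

(* [bcon] and [est] are this maximum for two choices of [P]. *)
Definition max_family (P : seq V -> Prop) : nat :=
  \max_(m < #|V|.+1 | `[< disj_family P m >]) m.

(** Disjoint nonempty tails number at most [#|V|], so the family lies in the range of the bounded
    maximum. *)
Lemma max_family_ge (P : seq V -> Prop) (Q : seq (seq V)) :
  (forall q, P q -> q != [::]) -> (forall q, q \in Q -> P q) -> uniq (flatten Q) ->
  size Q <= max_family P.
Proof.
move=> nP PQ uQ; have lt : size Q < #|V|.+1.
  rewrite ltnS; apply: (leq_trans (size_flatten_ge _)) => [q /PQ/nP //|].
  by rewrite cardE; apply: uniq_leq_size => // x _; rewrite mem_enum.
rewrite /max_family; have H : `[< disj_family P (Ordinal lt) >].
  by apply/asboolP; exists Q.
exact: (@leq_bigmax_cond _ (fun m : 'I_#|V|.+1 => `[< disj_family P m >])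
          (fun m => nat_of_ord m) _ H).
Qed.

Lemma max_family_le (P : seq V -> Prop) n :
  (forall Q : seq (seq V), (forall q, q \in Q -> P q) -> uniq (flatten Q) ->
    size Q <= n) -> max_family P <= n.
Proof. by move=> H; apply/bigmax_leqP => m /asboolP[Q [<- PQ uQ]]; apply: H. Qed.

Lemma shortest_qualN0 s r u q : shortest_qual e s r u q -> q != [::].
Proof. by case=> /andP[/qualpN0]. Qed.

Lemma eq_est s s' r u :
  (forall l q, l <= r -> qual e s l u q = qual e s' l u q) ->
  est e s r u = est e s' r u.
Proof.
move=> E; rewrite /est; congr (\big[_/_]_(m < _ | _) _).
suff -> : shortest_qual e s r u = shortest_qual e s' r u by [].
apply: funext => q; apply/propext; rewrite /shortest_qual E //.
by split=> -[Hq Hn]; split=> // -[q' [Hq' Hl]]; apply: Hn; exists q'; split=> //;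
  move: Hq'; rewrite E //; apply: leq_trans (leq_pred _) _; case/andP: Hq.
Qed.

(** The cut keeps the first vertex that is not below [w], which becomes the endpoint; without such a
    vertex all of [q] is kept. *)
Definition trunc s w q : seq V := take (find (fun x => ~~ pord s x w) q).+1 q.

Lemma trunc_subseq s w q : subseq (trunc s w q) q.
Proof. exact: take_subseq. Qed.

Lemma truncP s w q : has (fun x => ~~ pord s x w) q ->
  exists m a d, [/\ q = rcons m a ++ d, trunc s w q = rcons m a,
                    all (pord s ^~ w) m & ~~ pord s a w].
Proof.
rewrite /trunc; elim: q => //= x q IH; case: (boolP (pord s x w)) => [xw|xw _] /=.
  move=> /IH[m [a [d [-> E am aw]]]]; exists (x :: m), a, d.
  by rewrite /= xw E.
by exists [::], x, q; rewrite take0.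
Qed.

Lemma trunc_mem s w q x : x \in trunc s w q ->
  exists m d, q = rcons m x ++ d /\ all (pord s ^~ w) m.
Proof.
rewrite /trunc; elim: q => //= y q IH; rewrite inE => /orP[/eqP ->|].
  by exists [::], q.
case: (boolP (pord s y w)) => [yw|_] /=; last by rewrite take0.
by move=> /IH[m [d [-> am]]]; exists (y :: m), d; rewrite /= yw.
Qed.

Lemma trunc_qual s r w q : path e w q -> uniq (w :: q) ->
  has (fun x => ~~ pord s x w) q -> size q <= r -> qual e s r w (trunc s w q).
Proof.
move=> pq uq /truncP[m [a [d [E -> am aw]]]] szq.
rewrite /qual qualp_rcons am aw !andbT.
move: pq uq szq; rewrite E cat_path size_cat -cat_cons cat_uniq.
by case/andP=> -> _ /and3P[-> _ _]; apply: leq_trans (leq_addr _ _).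
Qed.

End Orders.

(** * Correctness of the keys and the bound on [est] for the greedy output *)

Section Greedy.
Variables (V : finType) (e : rel V) (r : nat).
Hypotheses (e_sym : symmetric e) (e_irr : irreflexive e) (r_gt0 : 0 < r).
Implicit Types (s t : seq V) (u v w : V) (q : seq V).

Lemma rev_path_sym w q : path e (last w q) (rev (belast w q)) = path e w q.
Proof. by rewrite rev_path; apply: eq_path => x y; rewrite e_sym. Qed.

(** With nothing placed, no vertex can be inner on a qualifying path, so these paths are the single
    edges at [v]. *)
Lemma est_nil v : est e [::] r v = deg e v.
Proof.
have single q : qual e [::] r v q -> exists2 x, q = [:: x] & e v x.
  case/lastP: q => [//|q x]; rewrite /qual qualp_rcons.
  case: q => [|y q]; last by rewrite /= !andbF.
  by rewrite /= andbT => /andP[/andP[evx _] _]; exists x.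
apply/eqP; rewrite eqn_leq; apply/andP; split.
  apply: max_family_le => Q HQ uQ; rewrite /deg cardE.
  apply: (leq_trans (size_flatten_ge _)) => [q /HQ/shortest_qualN0 //|].
  apply: uniq_leq_size => // x /flattenP[q /HQ[/single[y -> evy] _]].
  by rewrite inE mem_enum inE => /eqP ->.
rewrite /deg cardE -(size_map (fun x => [:: x])).
apply: max_family_ge => [q /shortest_qualN0 //|q|].
  case/mapP=> x; rewrite mem_enum inE => evx ->; split.
    rewrite /qual -[[:: x]]/(rcons [::] x) qualp_rcons /= evx r_gt0 inE !andbT.
    by apply: contraTneq evx => ->; rewrite e_irr.
  by case=> q' [/andP[/qualpN0]]; case: q'.
apply: uniq_flatten_map => [|//|x y _ _ z]; first exact: enum_uniq.
by rewrite !inE => /eqP -> /eqP.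
Qed.

(* A path from [v] that qualifies before or after [u] is placed and meets [u]
   starts with a path to [u] through placed vertices, whose reverse puts [v]
   in the reach of [u]. *)
Lemma est_rcons t u v : uniq (rcons t u) -> v \notin rcons t u ->
  v \notin reach e (rcons t u) r u -> est e (rcons t u) r v = est e t r v.
Proof.
rewrite rcons_uniq => /andP[uNt ut] vNtu vNr.
have vNt : v \notin t by apply: contraNN vNtu; rewrite mem_rcons inE orbC => ->.
have no_u c d : path e v (rcons c u ++ d) -> uniq (v :: rcons c u ++ d) ->
    size (rcons c u ++ d) <= r -> all (mem t) c -> False.
  rewrite cat_path -cat_cons cat_uniq size_cat => /andP[pc _] /and3P[uc _ _] sz ct.
  case/negP: vNr; rewrite inE; apply/asboolP; exists (rcons (rev c) v).
  rewrite last_rcons; split=> //.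
  have E : rcons (rev c) v = rev (belast v (rcons c u)).
    by rewrite belast_rcons rev_cons.
  rewrite /qual qualp_rcons size_rcons size_rev -(size_rcons c u).
  rewrite (leq_trans (leq_addr _ _) sz) andbT; apply/and4P; split.
  - by rewrite E -{1}(last_rcons v c u) rev_path_sym.
  - rewrite E belast_rcons -(rev_rcons (v :: c) u) rev_uniq.
    by rewrite -rcons_cons in uc.
  - by rewrite /pord (negPf vNtu).
  - apply/allP => p; rewrite mem_rev => /(allP ct) /= pt; rewrite /pord.
    rewrite mem_rcons inE pt orbT /= -cats1 !index_cat pt (negPf uNt).
    by rewrite ltn_addr ?index_mem ?orbT.
apply: eq_est => l q lr.
case/lastP: q => [//|q x]; rewrite /qual !qualp_rcons.
(* Since [v] is unplaced before and after, being below [v] means being placed. The two conditions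
   can differ only at [u], as an inner vertex or as the endpoint, and [no_u] excludes both. *)
rewrite !(pord_unplaced _ vNtu) !(pord_unplaced _ vNt).
rewrite (eq_all (fun p => pord_unplaced p vNtu)).
rewrite (eq_all (fun p => pord_unplaced p vNt)).
apply/idP/idP => /andP[/and4P[pq uq xN aq] sz].
  rewrite pq uq sz andbT /=; apply/andP; split.
    by apply: contraNN xN; rewrite mem_rcons inE orbC => ->.
  have [uin|uN] := boolP (u \in q); last first.
    apply/allP => y yq; move/allP/(_ _ yq): aq; rewrite /= mem_rcons inE.
    by case/orP=> // /eqP yu; rewrite -yu yq in uN.
  case/splitPr: uin pq uq sz aq => c d pq uq sz aq; case: (@no_u c (rcons d x)).
  + by rewrite cat_rcons -rcons_cons -rcons_cat.
  + by rewrite cat_rcons -rcons_cons -rcons_cat.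
  + by rewrite cat_rcons -rcons_cons -rcons_cat (leq_trans sz).
  + apply/allP => y yc; move: aq; rewrite all_cat => /andP[/allP/(_ _ yc) + _].
    rewrite /= mem_rcons inE => /orP[/eqP yu|//].
    move: uq; rewrite -cats1 -catA cons_uniq => /andP[_].
    rewrite cat_uniq => /and3P[_ /hasPn/(_ u)]; rewrite mem_head => /(_ isT) /=.
    by rewrite -yu yc.
rewrite pq uq sz andbT /=; apply/andP; split; last first.
  by apply/allP => y /(allP aq) /= yt; rewrite mem_rcons inE yt orbT.
rewrite mem_rcons inE (negPf xN) orbF; apply/negP => /eqP xu.
by apply: (@no_u q [::]); rewrite ?cats0 -?xu // (leq_trans sz).
Qed.

Lemma keys_est t v : uniq t -> v \notin t -> keys e r t v = est e t r v.
Proof.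
rewrite /keys; elim/last_ind: t => [|t u IH]; first by rewrite est_nil.
move=> utu vN; rewrite rev_rcons /= rev_cons revK; case: ifP => // /negbT vNr.
rewrite est_rcons // IH //; first by move: utu; rewrite rcons_uniq => /andP[].
by apply: contraNN vN; rewrite mem_rcons inE orbC => ->.
Qed.

(* Take [w] first, among the vertices outside [t], in an order that is optimal
   for [adm]: truncated paths from [w] qualify for that order. *)
Lemma exists_est_le_adm t v : v \notin t ->
  exists2 w, w \notin t & est e t r w <= adm e r.
Proof.
move=> vNt; rewrite /adm; case: ex_minnP => k /existsP[p /eqP <- _].
set o := perm_order p.
have oV x : x \in o.
  by apply/mapP; exists ((p^-1)%g x); rewrite ?mem_enum ?permKV.
case: (@arg_minnP _ v (fun w => w \notin t) (fun w => index w o) vNt) => w wNt wmin.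
exists w => //; apply: (@leq_trans (bcon e o r w)); last exact: leq_bigmax.
apply: max_family_le => Q HQ uQ; rewrite -(size_map (trunc o w)).
apply: max_family_ge => [q /andP[/qualpN0] //|q|]; last first.
  exact: subseq_uniq (subseq_flatten_map _ (trunc_subseq o w)) uQ.
case/mapP=> q' /HQ[/andP[]] + + _ ->; case/lastP: q' => // q' x.
rewrite qualp_rcons => /and4P[pq uq xw _] sz; apply: trunc_qual => //.
(* The endpoint [x] is not below the unplaced [w], so it is unplaced too; the choice of [w] then
   makes it a place where truncation stops. *)
apply/hasP; exists x; first by rewrite mem_rcons mem_head.
by rewrite pord_total // -leqNgt; apply: wmin; rewrite -(pord_unplaced _ wNt).
Qed.

(** Only the vertices placed before [u] are below [u], so its estimate is frozen at its key when it
    was picked, and that key was minimal. *)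
Lemma greedy_est_le_adm s u : greedy_run e r s -> est e s r u <= adm e r.
Proof.
case=> us sV greedy; pose i := index u s.
have ilt : i < size s by rewrite index_mem.
have uNt : u \notin take i s by rewrite in_take // ltnn.
have utk : uniq (take i s) by rewrite take_uniq.
have -> : est e s r u = est e (take i s) r u.
  apply: eq_est => l q _; congr (_ && _); apply: eq_qualp => p.
  by rewrite pord_total // (pord_unplaced _ uNt) in_take.
have [w wNt] := exists_est_le_adm uNt; apply: leq_trans.
by have := greedy i ilt w wNt; rewrite nth_index // !keys_est.
Qed.

End Greedy.

(** * Least walks through allowed vertices *)

Section MinimalWalks.
Variables (V : finType) (e : rel V) (u : V) (A : V -> pred V).
Implicit Types (v w x : V) (q : seq V).

(** Simplicity is not demanded, so segments can be exchanged freely; minimality restores it. *)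
Definition walk v q : bool :=
  [&& path e u q, last u q == v & all (fun x => (x == v) || A v x) q].

Definition minwalk v q : Prop :=
  walk v q /\ forall q', walk v q' -> wordval q <= wordval q'.

Lemma minwalk_ex v q : walk v q -> exists2 q', minwalk v q' & size q' <= size q.
Proof.
move=> wq; have ex : exists n, `[< exists2 q', walk v q' & wordval q' = n >].
  by exists (wordval q); apply/asboolP; exists q.
case: (ex_minnP ex) => n /asboolP[q' wq' <-] min; exists q'.
  by split=> // p wp; apply: min; apply/asboolP; exists p.
by apply: wordval_size; apply: min; apply/asboolP; exists q.
Qed.

Lemma walk_swap v c a b d : walk v (c ++ a ++ d) ->
  path e (last u c) b -> last (last u c) b = last (last u c) a ->
  all (fun x => (x == v) || A v x) b -> walk v (c ++ b ++ d).
Proof.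
rewrite /walk !cat_path !last_cat !all_cat => /and3P[/and3P[-> _ pd] ld].
by case/and3P=> -> _ -> -> -> ->; rewrite pd ld.
Qed.

(** Erasing loops keeps a walk admissible, so a least walk, having least length, has none. *)
Lemma minwalk_uniq v q : minwalk v q -> uniq (u :: q).
Proof.
case=> /and3P[pq lq aq] minq.
case: (shortenP pq) (lq) => p pp up sub lp.
have {sub}sub : {subset p <= q} by move=> x /sub.
have wp : walk v p.
  by rewrite /walk pp lp /=; apply/allP => x /sub; apply: (allP aq).
apply: (leq_size_uniq up) => [x|]; last exact: (wordval_size (minq _ wp)).
by rewrite !inE => /orP[->//|/sub ->]; rewrite orbT.
Qed.

End MinimalWalks.

(** * Branching in the prefix tree of the least walks *)

Section Trie.
Variables (V : finType) (e : rel V) (r k : nat) (s : seq V) (u : V).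
(** [R] is the set of targets, [P v] the chosen walk to [v], and [A v] the vertices allowed on it
    besides [v]. This treats both kinds of reachability at once: [A v] is later instantiated as the
    vertices below [u], or as those below [v]. *)
Variables (A : V -> pred V) (R : {set V}) (P : V -> seq V).
Hypothesis e_sym : symmetric e.
Hypothesis est_le : forall w, est e s r w <= k.
Hypothesis R_neq : {in R, forall v, v != u}.
Hypothesis A_below : {in R, forall v x, pord s x u -> A v x}.
Hypothesis A_down : {in R, forall v w x, A v w -> pord s x w -> A v x}.
Hypothesis A_irr : {in R, forall v, ~~ A v v}.
Hypothesis P_min : {in R, forall v, minwalk e u A v (P v)}.
Hypothesis P_size : {in R, forall v, size (P v) <= r}.
Implicit Types (v w x y : V) (c q : seq V).

Lemma P_walk v : v \in R -> walk e u A v (P v).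
Proof. by move=> /P_min[]. Qed.

Lemma P_last v : v \in R -> last u (P v) = v.
Proof. by move=> /P_walk/and3P[_ /eqP]. Qed.

Lemma P_allowed v x : v \in R -> x \in P v -> (x == v) || A v x.
Proof. by move=> /P_walk/and3P[_ _ /allP]; apply. Qed.

Lemma P_uniq v : v \in R -> uniq (u :: P v).
Proof. by move=> /P_min; apply: minwalk_uniq. Qed.

(** The walk is simple and ends in [v], so an earlier vertex differs from [v]. *)
Lemma P_inner v c a : v \in R -> P v = c ++ a -> a != [::] -> c != [::] ->
  A v (last u c).
Proof.
move=> vR Pv aN0; case/lastP: c Pv => // c w Pv _; rewrite last_rcons.
have : w \in P v by rewrite Pv mem_cat mem_rcons mem_head.
move/(P_allowed vR) => /orP[/eqP wv|//].
have := P_uniq vR; rewrite Pv cons_uniq cat_uniq => /andP[_ /and3P[_ /hasPn/(_ v)]].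
have va : v \in a.
  have := P_last vR; rewrite Pv last_cat last_rcons.
  by case: a aN0 {Pv} => //= y a _ <-; rewrite mem_last.
by move=> /(_ va) /=; rewrite mem_rcons wv mem_head.
Qed.

(** This is what permits rerouting: inner vertices of a path qualifying from a node of the walk may
    appear in walks to [v]. *)
Lemma below_allowed v c a x : v \in R -> P v = c ++ a -> a != [::] ->
  pord s x (last u c) -> A v x.
Proof.
move=> vR Pv aN0; case: (eqVneq c [::]) => [->|cN0]; first exact: A_below.
by apply: A_down => //; apply: (P_inner vR Pv).
Qed.

Lemma P_no_shortcut v c q q' d : v \in R -> P v = c ++ q ++ d ->
  path e (last u c) q' -> last (last u c) q' = last (last u c) q ->
  all (fun x => (x == v) || A v x) q' -> wordval (P v) <= wordval (c ++ q' ++ d).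
Proof.
move=> vR Pv pq' lq' aq'; case: (P_min vR) => wP; apply.
by apply: (walk_swap (a := q)) => //; rewrite -Pv.
Qed.

Lemma P_no_shorter v c q q' d : v \in R -> P v = c ++ q ++ d ->
  path e (last u c) q' -> last (last u c) q' = last (last u c) q ->
  all (fun x => (x == v) || A v x) q' -> size q <= size q'.
Proof.
move=> vR Pv pq' lq' aq'; have := P_no_shortcut vR Pv pq' lq' aq'.
by move/wordval_size; rewrite Pv !size_cat leq_add2l leq_add2r.
Qed.

(** The target itself stops the truncation: if it were below the node, it would be allowed before
    itself. *)
Lemma P_has v c a : v \in R -> P v = c ++ a -> a != [::] ->
  has (fun x => ~~ pord s x (last u c)) a.
Proof.
move=> vR Pv aN0; apply/hasP; exists v.
  have := P_last vR; rewrite Pv last_cat.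
  by case: a aN0 {Pv} => //= y a _ <-; rewrite mem_last.
by apply: contraNN (A_irr vR); apply: below_allowed Pv aN0.
Qed.

(** A shorter qualifying path to the cut vertex could replace the cut piece and would shorten
    [P v]. *)
Lemma trunc_down v c a : v \in R -> P v = c ++ a -> a != [::] ->
  shortest_qual e s r (last u c) (trunc s (last u c) a).
Proof.
move=> vR Pv aN0; set w := last u c.
have hasa := P_has vR Pv aN0.
have /and3P[pP _ _] := P_walk vR.
split.
  apply: trunc_qual => //.
  - by move: pP; rewrite Pv cat_path => /andP[].
  - have := P_uniq vR; rewrite Pv -cat_cons lastI cat_rcons cat_uniq.
    by case/and3P.
  - by apply: leq_trans (P_size vR); rewrite Pv size_cat leq_addl.
case=> q' [/andP[]]; case/truncP: hasa => m [b [d [Ea -> am bw]]].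
case/lastP: q' => // q' x; rewrite qualp_rcons => /and4P[pq' _ _ aq'] sz.
rewrite !last_rcons => xb; rewrite {x}xb in pq' sz.
move: sz; rewrite leqNgt prednK; last by rewrite size_rcons.
case/negP.
apply: (@P_no_shorter v c _ _ d) => //; rewrite -?Ea ?last_rcons //.
apply/allP => x; rewrite mem_rcons inE => /orP[/eqP ->|/(allP aq') xw].
  by apply: P_allowed; rewrite // Pv Ea !mem_cat mem_rcons mem_head orbT.
by rewrite (below_allowed vR Pv aN0) ?orbT.
Qed.

(** If two cut branches met in [x], each could use the other's piece up to [x]. Minimality of both
    walks forces the pieces to agree, hence also their first vertices. *)
Lemma trunc_disjoint v v' c a a' x : v \in R -> v' \in R ->
  P v = c ++ a -> P v' = c ++ a' ->
  x \in trunc s (last u c) a -> x \in trunc s (last u c) a' -> ohead a = ohead a'.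
Proof.
move=> vR v'R Pv Pv' /trunc_mem[m [d [Ea am]]] /trunc_mem[m' [d' [Ea' am']]].
rewrite {}Ea in Pv *; rewrite {}Ea' in Pv' *.
suff swap v1 v2 m1 m2 d1 d2 : v1 \in R -> v2 \in R ->
    P v1 = c ++ rcons m1 x ++ d1 -> P v2 = c ++ rcons m2 x ++ d2 ->
    all (pord s ^~ (last u c)) m2 ->
    wordval (P v1) <= wordval (c ++ rcons m2 x ++ d1).
  have le1 := swap _ _ _ _ _ _ vR v'R Pv Pv' am'.
  have le2 := swap _ _ _ _ _ _ v'R vR Pv' Pv am.
  rewrite Pv in le1; rewrite Pv' in le2.
  (* Lengths are compared first; only for equal lengths can the common parts be cancelled from the
     values. *)
  have sz : size (rcons m x) = size (rcons m' x).
    move/wordval_size: (le1); move/wordval_size: (le2).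
    rewrite !size_cat !leq_add2l !leq_add2r => h1 h2; apply/eqP.
    by rewrite eqn_leq h1 h2.
  move: le1 le2; rewrite !wordval_infix // => le1 le2.
  have -> : rcons m x = rcons m' x.
    by apply: wordval_inj => //; apply/eqP; rewrite eqn_leq le1 le2.
  by case: (m').
move=> v1R v2R P1 P2 am2; apply: (P_no_shortcut v1R P1); rewrite ?last_rcons //.
  by have /and3P[] := P_walk v2R; rewrite P2 !cat_path => /and3P[].
apply/allP => y; rewrite mem_rcons inE => /orP[/eqP ->|/(allP am2) yw].
  by apply: P_allowed; rewrite // P1 !mem_cat mem_rcons mem_head orbT.
by rewrite (below_allowed v1R P1) ?orbT //; case: (m1).
Qed.

Definition children c : {set V} :=
  [set y | [exists v in R, prefix (rcons c y) (P v)]].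

Lemma childrenP c y : reflect (exists2 v, v \in R & exists z, P v = c ++ y :: z)
  (y \in children c).
Proof.
rewrite inE; apply: (iffP existsP) => [[v /andP[vR /prefixP[z Pv]]]|[v vR [z Pv]]].
  by exists v => //; exists z; rewrite Pv cat_rcons.
by exists v; rewrite vR Pv -cat_rcons prefix_prefix.
Qed.

(** One walk is chosen through each child and cut. That each member lies beyond [c] is recorded so
    that a path inside [u :: c] can be added later. *)
Lemma children_family c : exists Q : seq (seq V),
  [/\ size Q = #|children c|, uniq (flatten Q) &
   forall q, q \in Q -> shortest_qual e s r (last u c) q /\
     exists v a, [/\ v \in R, P v = c ++ a & {subset q <= a}]].
Proof.
have /choice[f fP] y : exists a, y \in children c ->
    ohead a = Some y /\ exists2 v, v \in R & P v = c ++ a.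
  have [/childrenP[v vR [z Pv]]|yN] := boolP (y \in children c).
    by exists (y :: z) => _; split=> //; exists v.
  by exists [::].
have fN0 y : y \in children c -> f y != [::].
  by case/fP; case: (f y).
exists [seq trunc s (last u c) (f y) | y <- enum (children c)]; split.
- by rewrite size_map -cardE.
- apply: uniq_flatten_map; first exact: enum_uniq.
    move=> y; rewrite mem_enum => /fP[_ [v vR Pv]].
    have := P_uniq vR; rewrite Pv -cat_cons cat_uniq => /and3P[_ _].
    exact: subseq_uniq (trunc_subseq _ _ _).
  move=> y y'; rewrite !mem_enum => /fP[fy [v vR Pv]] /fP[fy' [v' v'R Pv']] x xy xy'.
  by have := trunc_disjoint vR v'R Pv Pv' xy xy'; rewrite fy fy' => -[].
- move=> _ /mapP[y + ->]; rewrite mem_enum => yc.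
  have [_ [v vR Pv]] := fP y yc; split; first exact: trunc_down Pv (fN0 _ yc).
  by exists v, (f y); split=> //; apply: mem_subseq (trunc_subseq _ _ _).
Qed.

Lemma card_children c : #|children c| <= k.
Proof.
have [Q [<- uQ HQ]] := children_family c; apply: leq_trans (est_le (last u c)).
by apply: max_family_ge => // [q /shortest_qualN0 //|q /HQ[]].
Qed.

(** A shorter qualifying path from the node back to the cut vertex, reversed, would shorten the walk
    on its way down to the node. *)
Lemma trunc_up v c a : v \in R -> P v = c ++ a -> a != [::] ->
  ~~ pord s u (last u c) -> c != [::] ->
  shortest_qual e s r (last u c) (trunc s (last u c) (rev (belast u c))).
Proof.
move=> vR Pv aN0 uw cN0; set w := last u c.
have uN0 : u \in rev (belast u c) by case: (c) cN0 => // x c' _; rewrite mem_rev mem_head.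
have hasu : has (fun x => ~~ pord s x w) (rev (belast u c)).
  by apply/hasP; exists u.
have /and3P[pP _ _] := P_walk vR.
split.
  apply: trunc_qual => //.
  - by rewrite rev_path_sym //; move: pP; rewrite Pv cat_path => /andP[].
  - rewrite -rev_rcons -lastI rev_uniq.
    by have := P_uniq vR; rewrite Pv -cat_cons cat_uniq => /andP[].
  - apply: leq_trans (P_size vR); rewrite Pv size_cat size_rev size_belast.
    exact: leq_addr.
case/truncP: hasu => m [b [d [Eu -> am bw]]].
case=> q' [/andP[]]; case/lastP: q' => // q' x.
rewrite qualp_rcons => /and4P[pq' _ _ aq'] sz.
rewrite !last_rcons => xb; rewrite {x}xb in pq' sz.
have szd : size d <= size c.
  by rewrite -(size_belast u c) -(size_rev (belast u c)) Eu size_cat leq_addl.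
(* [c1] is the part of [c] from [u] to the cut vertex [b], and [c2] the part from [b] to [w]: the
   way back traverses [c2] and leaves [d] over. *)
have Ec : c = take (size d) c ++ drop (size d) c by rewrite cat_take_drop.
set c1 := take _ _ in Ec; set c2 := drop _ _ in Ec.
have wE : w = last (last u c1) c2 by rewrite /w Ec last_cat.
have [E1 E2] : rev (belast (last u c1) c2) = rcons m b /\ rev (belast u c1) = d.
  move: (Eu); rewrite {1}Ec belast_cat rev_cat => /eqP; rewrite eqseq_cat.
    by case/andP=> /eqP -> /eqP ->.
  move/(congr1 size): Eu; rewrite size_rev size_belast size_cat size_rev size_belast.
  by rewrite size_drop => ->; rewrite addnK.
have bE : b = last u c1.
  have c2N0 : c2 != [::] by apply: contra_eqN E1 => /eqP ->; case: (m).
  case: (c2) c2N0 E1 => // y c3 _ /=; rewrite rev_cons.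
  by case/rcons_inj.
have sz2 : size c2 = size (rcons m b) by rewrite -E1 size_rev size_belast.
move: sz; rewrite -sz2 leqNgt prednK; last by rewrite sz2 size_rcons.
case/negP; rewrite -[size (rcons q' b)](size_belast w) -(size_rev (belast w _)).
have lw : last b (rev (belast w (rcons q' b))) = w.
  by rewrite belast_rcons rev_cons last_rcons.
(* The reversal of the path from [w] to [b] takes the place of [c2]. *)
apply: (@P_no_shorter v c1 _ _ a) => //; rewrite -?bE ?lw //.
- by rewrite Pv {1}Ec catA.
- by rewrite -{1}(last_rcons w q' b) rev_path_sym.
- by rewrite bE -wE.
apply/allP => x; rewrite mem_rev belast_rcons inE => /orP[/eqP ->|/(allP aq') xw].
  by rewrite (P_inner vR Pv) ?orbT.
by rewrite (below_allowed vR Pv aN0) ?orbT.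
Qed.

Definition subtree c : {set V} := [set v in R | prefix c (P v)].

(** A walk determines its target, so at most one target ends exactly at [c]; the boolean counts
    it. *)
Lemma card_subtree c :
  #|subtree c| <= [exists v in R, P v == c]
                  + \sum_(y in children c) #|subtree (rcons c y)|.
Proof.
have : subtree c \subset [set v in R | P v == c]
                       :|: \bigcup_(y in children c) subtree (rcons c y).
  apply/subsetP => v; rewrite !inE => /andP[vR /prefixP[[|y z] Pv]]; rewrite vR /=.
    by rewrite Pv cats0 eqxx.
  apply/orP; right; apply/bigcupP; exists y; first by apply/childrenP; exists v => //; exists z.
  by rewrite inE vR Pv -cat_rcons prefix_prefix.
move/subset_leq_card/leq_trans; apply; apply: leq_trans (leq_card_setU _ _) _.
apply: leq_add.
  have [ex|nex] := boolP [exists v in R, P v == c].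
    rewrite /= -(cards1 (last u c)); apply: subset_leq_card; apply/subsetP => v.
    by rewrite !inE => /andP[vR /eqP <-]; rewrite P_last.
  rewrite leqn0 cards_eq0; apply/eqP/setP => v; rewrite !inE.
  by apply: contraNF nex => H; apply/existsP; exists v.
elim/big_ind2: _ => [|n1 X1 n2 X2 H1 H2|y _]; rewrite ?cards0 //.
by apply: leq_trans (leq_card_setU _ _) _; apply: leq_add.
Qed.

Lemma children_deep c : r <= size c -> children c = set0.
Proof.
move=> rc; apply/setP => y; rewrite in_set0; apply/negP => /childrenP[v vR [z Pv]].
have := P_size vR; rewrite Pv size_cat /= addnS leqNgt ltnS.
by rewrite (leq_trans rc) ?leq_addr.
Qed.

(** At most [n] levels remain below [c], each at most [k] times as large as the one above it. *)
Lemma card_subtree_le n c : r <= size c + n ->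
  #|subtree c| <= \sum_(i < n.+1) k ^ i.
Proof.
elim: n c => [|n IH] c rc; apply: leq_trans (card_subtree c) _.
  rewrite addn0 in rc; rewrite children_deep // big_set0 addn0 big_ord1.
  exact: leq_b1.
rewrite big_ord_recl leq_add ?leq_b1 //.
apply: (@leq_trans (\sum_(y in children c) \sum_(i < n.+1) k ^ i)).
  by apply: leq_sum => y _; apply: IH; rewrite size_rcons addSnnS.
rewrite sum_nat_const; apply: (leq_trans (leq_mul (card_children c) (leqnn _))).
by rewrite big_distrr /=; apply: leq_sum => i _; rewrite -expnS.
Qed.

Lemma card_targets_le : #|R| <= \sum_(i < r.+1) k ^ i.
Proof.
have <- : subtree [::] = R by apply/setP => v; rewrite inE prefix0s andbT.
exact: card_subtree_le.
Qed.

(** From here on the setting is strong reachability: allowed vertices are below [u]. *)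
Hypothesis A_strict : {in R, forall v x, A v x -> pord s x u}.
Hypothesis pord_asym : forall x y, pord s x y -> ~~ pord s y x.

(** The cut way back to [u] stays inside [u :: c], the cut branches beyond it, so it enlarges the
    disjoint family by one. *)
Lemma card_children_inner c : c != [::] -> #|children c| <= k - 1.
Proof.
move=> cN0; have [->|[y /childrenP[v vR [z Pv]]]] := set_0Vmem (children c).
  by rewrite cards0.
have uw : ~~ pord s u (last u c).
  by apply: pord_asym; apply: A_strict (vR) _ (P_inner vR Pv _ cN0).
(* The existing child [y] gives [1 <= k], which makes the truncated subtraction exact. *)
have [Q [szQ uQ HQ]] := children_family c; rewrite -szQ leq_subRL ?add1n; last first.
  apply: leq_trans (card_children c); apply/card_gt0P; exists y.
  by apply/childrenP; exists v => //; exists z.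
apply: leq_trans (est_le (last u c)).
set q0 := trunc s (last u c) (rev (belast u c)).
rewrite -[_.+1]/(size (q0 :: Q)); apply: max_family_ge => [q /shortest_qualN0 //|q|].
  rewrite inE => /orP[/eqP ->|/HQ[]//].
  by apply: trunc_up vR Pv _ uw cN0.
have q0c : {subset q0 <= u :: c}.
  by move=> x /(mem_subseq (trunc_subseq _ _ _)); rewrite mem_rev => /mem_belast.
rewrite /= cat_uniq uQ andbT; apply/andP; split.
  apply: subseq_uniq (trunc_subseq _ _ _) _; rewrite rev_uniq.
  have := P_uniq vR; rewrite Pv -cat_cons cat_uniq lastI rcons_uniq.
  by case/andP=> /andP[].
apply/hasPn => x /flattenP[q /HQ[_ [v' [a [v'R Pv' qa]]]] /qa xa] /=.
have := P_uniq v'R; rewrite Pv' -cat_cons cat_uniq => /and3P[_ /hasPn/(_ x xa) + _].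
by apply: contraNN => /q0c.
Qed.

(** A target with a walk continuing past it would be below [u], hence allowed before itself. *)
Lemma children_leaf c v : v \in R -> P v = c -> children c = set0.
Proof.
move=> vR Pv; apply/setP => y; rewrite in_set0; apply/negP => /childrenP[v' v'R [z Pv']].
have cN0 : c != [::].
  by apply: contraNneq (R_neq vR) => c0; rewrite -(P_last vR) Pv c0.
have := P_inner v'R Pv' isT cN0; rewrite -Pv P_last // => /(A_strict v'R) vu.
by have := A_irr vR; rewrite A_below.
Qed.

(** A node either ends a walk and is a leaf, counted by [1 <= (k - 1) ^ n], or only passes its count
    to at most [k - 1] children. *)
Lemma card_subtree_inner n c : 1 < k -> c != [::] -> r <= size c + n ->
  #|subtree c| <= (k - 1) ^ n.
Proof.
move=> k1; elim: n c => [|n IH] c cN0 rc; apply: leq_trans (card_subtree c) _.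
  rewrite addn0 in rc; rewrite children_deep // big_set0 addn0.
  exact: leq_b1.
have [/existsP[v /andP[vR /eqP Pv]]|_] := boolP [exists v in R, P v == c].
  by rewrite (children_leaf vR Pv) big_set0 addn0 expn_gt0 subn_gt0 k1.
apply: (@leq_trans (\sum_(y in children c) (k - 1) ^ n)).
  apply: leq_sum => y _; apply: IH; last by rewrite size_rcons addSnnS.
  by case: (c).
by rewrite sum_nat_const expnS leq_mul2r card_children_inner ?orbT.
Qed.

Lemma card_targets_strict_le : 0 < r -> k != 1 -> #|R| <= k * (k - 1) ^ (r - 1).
Proof.
move=> r0 kN1; have <- : subtree [::] = R.
  by apply/setP => v; rewrite inE prefix0s andbT.
apply: leq_trans (card_subtree [::]) _.
have -> : [exists v in R, P v == [::]] = false.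
  apply/existsP => -[v /andP[vR /eqP Pv]].
  by have := R_neq vR; rewrite -{1}(P_last vR) Pv eqxx.
(* The root has no way back, so the factor there is [k]. For [k = 0] it has no children and [R] is
   empty. *)
have := card_children [::]; rewrite add0n; case: (ltngtP k 1) kN1 => // k1 _.
  move: k1; rewrite ltnS leqn0 => /eqP ->; rewrite leqn0 cards_eq0 => /eqP ->.
  by rewrite big_set0.
move=> chk; apply: (@leq_trans (\sum_(y in children [::]) (k - 1) ^ (r - 1))).
  by apply: leq_sum => y _; apply: card_subtree_inner; rewrite //= subnKC.
by rewrite sum_nat_const leq_mul2r chk orbT.
Qed.

End Trie.

(** * The two colouring bounds as instances of the tree count *)

Section Colouring.
Variables (V : finType) (e : rel V) (r k : nat) (s : seq V).
Hypotheses (e_sym : symmetric e) (s_uniq : uniq s) (s_full : forall v, v \in s).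
Hypothesis est_le : forall w, est e s r w <= k.

Lemma minwalks_ex u (A : V -> pred V) (R : {set V}) :
  {in R, forall v, exists2 q, walk e u A v q & size q <= r} ->
  exists P : V -> seq V,
    {in R, forall v, minwalk e u A v (P v)} /\ {in R, forall v, size (P v) <= r}.
Proof.
move=> HR; have /choice[P HP] v : exists q, v \in R ->
    minwalk e u A v q /\ size q <= r.
  have [vR|] := boolP (v \in R); last by exists [::].
  have [q /minwalk_ex[q' mq' sz'] sz] := HR v vR.
  by exists q' => _; split=> //; apply: leq_trans sz.
by exists P; split=> v /HP[].
Qed.

Lemma pord_trans : transitive (pord s).
Proof. by move=> b a c; rewrite !pord_total //; apply: ltn_trans. Qed.

Lemma pord_asym a b : pord s a b -> ~~ pord s b a.
Proof. by rewrite !pord_total // -leqNgt => /ltnW. Qed.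

Lemma pord_irr a : ~~ pord s a a.
Proof. by rewrite pord_total // ltnn. Qed.

Lemma pord_connex a b : a != b -> ~~ pord s a b -> pord s b a.
Proof.
rewrite !pord_total // -leqNgt ltn_neqAle => ab ->; rewrite andbT.
by apply: contraNneq ab => /(congr1 (nth a s)); rewrite !nth_index // => ->.
Qed.

Lemma colr_le : 0 < r -> k != 1 -> colr e s r <= k * (k - 1) ^ (r - 1).
Proof.
move=> r0 k1; apply/bigmax_leqP => u _; set R := reach e s r u.
have RP v : v \in R -> exists q, [/\ path e u (rcons q v), v != u,
    ~~ pord s v u, all (pord s ^~ u) q & size (rcons q v) <= r].
  rewrite inE => /asboolP[q []]; case/lastP: q => [//|q x].
  rewrite /qual qualp_rcons last_rcons => /andP[/and4P[pq uq xu aq] sz] <-.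
  exists q; split=> //; apply: contraTneq uq => ->.
  by rewrite /= mem_rcons mem_head.
pose A (_ : V) := pord s ^~ u.
have [P [Pmin Psz]] : exists P : V -> seq V,
    {in R, forall v, minwalk e u A v (P v)} /\ {in R, forall v, size (P v) <= r}.
  apply: minwalks_ex => v /RP[q [pq vu _ aq sz]]; exists (rcons q v) => //.
  rewrite /walk pq last_rcons eqxx all_rcons eqxx /=.
  by apply: sub_all aq => x; rewrite /A => ->; rewrite orbT.
apply: (@card_targets_strict_le _ e r k s u A R P) => //.
- by move=> v /RP[q []].
- by move=> v _ w x wu /pord_trans; apply.
- by move=> v /RP[q []].
- exact: pord_asym.
Qed.

Lemma wcolr_le : wcolr e s r <= \sum_(i < r.+1) k ^ i.
Proof.
apply/bigmax_leqP => u _; set R := wreach e s r u.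
have RP v : v \in R -> exists q, [/\ path e u (rcons q v), v != u,
    ~~ pord s v u, all (pord s ^~ v) q & size (rcons q v) <= r].
  rewrite inE => /asboolP[q []]; case/lastP: q => [//|q x].
  rewrite /wqual wqualp_rcons last_rcons => /andP[/and4P[pq uq xu aq] sz] <-.
  exists q; split=> //; apply: contraTneq uq => ->.
  by rewrite /= mem_rcons mem_head.
pose A (v : V) := pord s ^~ v.
have [P [Pmin Psz]] : exists P : V -> seq V,
    {in R, forall v, minwalk e u A v (P v)} /\ {in R, forall v, size (P v) <= r}.
  apply: minwalks_ex => v /RP[q [pq vu _ aq sz]]; exists (rcons q v) => //.
  rewrite /walk pq last_rcons eqxx all_rcons eqxx /=.
  by apply: sub_all aq => x; rewrite /A => ->; rewrite orbT.
apply: (@card_targets_le _ e r k s u A R P) => //.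
(* By totality [u] is below every weakly reached [v], so whatever is below [u] is below [v]. *)
- by move=> v /RP[q [_ vu vNu _ _]] x /pord_trans; apply; apply: pord_connex.
- by move=> v _ w x wu /pord_trans; apply.
- by move=> v _; apply: pord_irr.
Qed.

End Colouring.

Theorem theorem4p8 (V : finType) (e : rel V) (r : nat) (s : seq V) :
  symmetric e -> irreflexive e -> (1 <= r)%N ->
  greedy_run e r s ->
  (adm e r != 1)%N ->
  (colr e s r <= adm e r * (adm e r - 1) ^ (r - 1))%N /\
  ((wcolr e s r)%:R <= ((adm e r)%:R ^+ r.+1 - 1) / ((adm e r)%:R - 1) :> rat)%R.
Proof.
move=> e_sym e_irr r0 run k1.
have est_le w := greedy_est_le_adm e_sym e_irr r0 w run.
have [us sV _] := run; split; first exact: colr_le.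
have kN0 : ((adm e r)%:R - 1 != 0 :> rat)%R by rewrite subr_eq0 pnatr_eq1.
(* The quotient is the geometric sum, valid in [rat] because the denominator is nonzero. *)
rewrite subrX1 mulrC mulKf //.
have -> : (\sum_(i < r.+1) (adm e r)%:R ^+ i = (\sum_(i < r.+1) adm e r ^ i)%N%:R :> rat)%R.
  by rewrite natr_sum; apply: eq_bigr => i _; rewrite natrX.
by rewrite ler_nat; apply: wcolr_le.
Qed.
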